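(* Let $n,m\ge 1$ be integers and let $\pi$ be a probability distribution on a parameter space of vectors $\theta$. For each $i=1,\ldots,n$ and each $\theta$, let $A_i(\theta)$ be a well-defined $m\times m$ nonnegative definite matrix. For $w=(w_1,\ldots,w_n)$ put $M(w,\theta)=\sum_{i=1}^n w_i A_i(\theta)$, and define $$\phi(w)=\int \log\det M(w,\theta)\,\mathrm{d}\pi(\theta),\qquad d_i(w)=\int \operatorname{tr}\big(M^{-1}(w,\theta)A_i(\theta)\big)\,\mathrm{d}\pi(\theta),\quad i=1,\ldots,n.$$ Let $\Omega=\{w\in\mathbb{R}^n:\ \sum_{i=1}^n w_i=1,\ w_i>0 \text{ for all } i\}$. Assume $\phi(w)$ is finite for at least one $w\in\Omega$. Let $w^{(t)},w^{(t+1)}\in\Omega$ and a real number $\alpha^{(t)}$ satisfy $$w_i^{(t+1)}=w_i^{(t)}\,\frac{d_i\big(w^{(t)}\big)-\alpha^{(t)}}{m-\alpha^{(t)}},\quad i=1,\ldots,n,\qquad\text{where}\qquad \alpha^{(t)}\le \frac12\min_{1\le i\le n} d_i\big(w^{(t)}\big).$$ Then $\phi\big(w^{(t+1)}\big)\ge\phi\big(w^{(t)}\big)$, with equality only if $w^{(t+1)}=w^{(t)}$.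
   Context: $\phi$ is the Bayesian D-optimality criterion for an approximate design with weights $w_i$ on a finite design space $\{x_1,\ldots,x_n\}$, where $A_i(\theta)$ is the Fisher information matrix for the $m$-dimensional parameter $\theta$ from one unit at design point $x_i$. $M^{-1}$ denotes the matrix inverse. *)

(* Defs.v *)
From HB Require Import structures.
From mathcomp Require Import all_boot all_order all_algebra.
From mathcomp Require Import all_classical all_reals all_analysis.
Set Implicit Arguments. Unset Strict Implicit. Unset Printing Implicit Defensive.
Import Order.TTheory GRing.Theory Num.Theory.
Local Open Scope ring_scope.

Definition nonneg_def (R : realType) (m : nat) (A : 'M[R]_m) : Prop :=
  A^T = A /\ forall x : 'cV[R]_m, 0 <= (x^T *m A *m x) 0 0.

Definition infoM (R : realType) (T : Type) (n m : nat)
  (A : 'I_n -> T -> 'M[R]_m) (w : 'I_n -> R) (t : T) : 'M[R]_m :=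
  \sum_(i < n) w i *: A i t.

(* log det, with log 0 = -oo (det of a nonnegative definite matrix is >= 0) *)
Definition logdet (R : realType) (m : nat) (M : 'M[R]_m) : \bar R :=
  if 0 < \det M then (ln (\det M))%:E else -oo%E.

Definition phiD (R : realType) (d : measure_display) (T : measurableType d)
  (P : probability T R) (n m : nat) (A : 'I_n -> T -> 'M[R]_m)
  (w : 'I_n -> R) : \bar R :=
  (\int[P]_(t in setT) logdet (infoM A w t))%E.

Definition dfun (R : realType) (d : measure_display) (T : measurableType d)
  (P : probability T R) (n m : nat) (A : 'I_n -> T -> 'M[R]_m)
  (i : 'I_n) (w : 'I_n -> R) : R :=
  Rintegral P setT (fun t => \tr (invmx (infoM A w t) *m A i t)).

Definition Omega (R : realType) (n : nat) (w : 'I_n -> R) : Prop :=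
  \sum_(i < n) w i = 1 /\ forall i, 0 < w i.

(* Main.v *)
Require Import Defs.
From HB Require Import structures.
From mathcomp Require Import all_boot all_order all_algebra.
From mathcomp Require Import all_classical all_reals all_analysis.
From mathcomp Require Import measurable_realfun complex ring lra.
Import Order.TTheory GRing.Theory Num.Theory.
Import numFieldNormedType.Exports.
Local Open Scope ring_scope.
Set Implicit Arguments. Unset Strict Implicit.

(** Put [r_i = w1_i / w0_i] and let [M = \sum_i C_i] be positive definite with
    nonnegative definite [C_i]. Diagonalizing [M] (to the identity) and
    [N = \sum_i r_i C_i] simultaneously and applying Jensen's inequality to [ln]
    on each diagonal entry gives
      [ln det N >= ln det M + \sum_i tr (M^-1 C_i) ln r_i].
    With [C_i = w0_i A_i], integration yields
      [phi w1 >= phi w0 + \sum_i w0_i d_i ln r_i].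
    With [rho = alpha / (m - alpha)] one has [d_i = (m - alpha) (r_i + rho)],
    and [x |-> (x + rho) ln x] is convex where [x >= rho]; the bound on [alpha]
    says exactly that [rho <= r_i] (and implies [rho <= 1]). Its tangent at [1] thus
    gives [(r_i + rho) ln r_i >= (1 + rho) (r_i - 1)], strictly unless
    [r_i = 1], and the right-hand sides average to [0] under [w0]. *)

(** * Simultaneous diagonalization of Hermitian forms by congruence *)

Section hermitian.
Local Open Scope sesquilinear_scope.

Definition hermitian_psd (C : numClosedFieldType) (m : nat) (A : 'M[C]_m) :
    Prop :=
  A \is hermsymmx /\ forall x : 'rV[C]_m, 0 <= (x *m A *m x^t*) 0 0.

Lemma hermitian_psd_sum (C : numClosedFieldType) (m n : nat)
    (A : 'I_n -> 'M[C]_m) (r : 'I_n -> C) :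
  (forall i, 0 <= r i) -> (forall i, hermitian_psd (A i)) ->
  hermitian_psd (\sum_i r i *: A i).
Proof.
move=> r0 hA; split.
  apply/is_hermitianmxP; rewrite expr0 scale1r.
  rewrite linear_sum/= raddf_sum/=; apply: eq_bigr => i _.
  have [/is_hermitianmxP] := hA i; rewrite expr0 scale1r => hAi _.
  rewrite linearZ/= map_mxZ/= -hAi; congr (_ *: _).
  exact/esym/CrealP/ger0_real.
move=> x; rewrite mulmx_sumr mulmx_suml summxE sumr_ge0// => i _.
by rewrite -scalemxAr -scalemxAl mxE mulr_ge0//; case: (hA i).
Qed.

Lemma hermitian_psd_congr (C : numClosedFieldType) (m : nat) (A U : 'M[C]_m) :
  hermitian_psd A -> hermitian_psd (U *m A *m U^t*).
Proof.
move=> [/is_hermitianmxP]; rewrite expr0 scale1r => hA pA; split.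
  apply/is_hermitianmxP; rewrite expr0 scale1r.
  by rewrite !trmx_mul !map_mxM/= !trmxCK mulmxA -hA.
by move=> x; have := pA (x *m U); rewrite trmx_mul map_mxM/= !mulmxA.
Qed.

Lemma hermitian_psd_diag_ge0 (C : numClosedFieldType) (m : nat)
    (A : 'M[C]_m) j :
  hermitian_psd A -> 0 <= A j j.
Proof.
move=> [_ /(_ (delta_mx 0 j))]; rewrite -rowE trmx_delta map_delta_mx -colE.
by rewrite !mxE.
Qed.

Lemma hermitian_diag (C : numClosedFieldType) (m : nat) (A : 'M[C]_m) :
  A \is hermsymmx -> exists2 P : 'M[C]_m, P \is unitarymx &
    exists D, P *m A *m P^t* = diag_mx D.
Proof.
move=> /hermitian_normalmx/orthomx_spectralP hA.
have U := spectral_unitarymx A.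
exists (spectralmx A) => //; exists (spectral_diag A).
rewrite {2}hA !mulmxA mulmxV ?spectral_unit// mul1mx.
by rewrite -mulmxA (unitarymxP U) mulmx1.
Qed.

(** Diagonalize unitarily, then rescale each eigenvector by the inverse square root of its
    eigenvalue. *)
Lemma hermitian_psd_unit_congr1 (C : numClosedFieldType) (m : nat)
    (A : 'M[C]_m) :
  hermitian_psd A -> A \in unitmx ->
  exists2 W : 'M[C]_m, W \in unitmx & W *m A *m W^t* = 1%:M.
Proof.
move=> pA Au; have [P /unitarymx_unit Pu [D PD]] := hermitian_diag (proj1 pA).
(* Congruence keeps diagonal entries nonnegative; a zero entry would annihilate the determinant,
   which is a unit. *)
have D0 j : 0 < D 0 j.
  have := hermitian_psd_diag_ge0 j (hermitian_psd_congr P pA).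
  rewrite PD !mxE eqxx mulr1n le_eqVlt eq_sym => /predU1P[D0|//].
  have : \det (P *m A *m P^t*) != 0.
    rewrite !det_mulmx det_map_mx det_tr !mulf_neq0 ?conjC_eq0//;
      by rewrite -unitfE -unitmxE.
  by rewrite PD det_diag (bigD1 j)//= D0 mul0r eqxx.
pose E : 'rV[C]_m := \row_j (sqrtC (D 0 j))^-1.
have E0 j : 0 < E 0 j by rewrite mxE invr_gt0 sqrtC_gt0.
exists (diag_mx E *m P).
  rewrite unitmx_mul Pu andbT unitmxE det_diag unitfE.
  by apply/prodf_neq0 => j _; rewrite lt0r_neq0.
rewrite trmx_mul map_mxM/= tr_diag_mx map_diag_mx !mulmxA -(mulmxA _ P).
rewrite -(mulmxA _ (P *m A)) PD !mulmx_diag.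
apply/matrixP => i j; rewrite !mxE; congr (_ *+ _).
move: (E0 i); rewrite mxE => /gtr0_real/CrealP Ei; rewrite [X in _ * X]Ei.
by rewrite mulrAC -expr2 exprVn sqrtCK mulVf// lt0r_neq0.
Qed.

(** [W] turns [A] into the identity; a unitary [Q] diagonalizing the transformed [B] then leaves
    that identity fixed. *)
Lemma simultaneous_diag (C : numClosedFieldType) (m : nat) (A B : 'M[C]_m) :
  hermitian_psd A -> A \in unitmx -> B \is hermsymmx ->
  exists2 U : 'M[C]_m, U *m A *m U^t* = 1%:M &
    exists D, U *m B *m U^t* = diag_mx D.
Proof.
move=> pA Au /is_hermitianmxP; rewrite expr0 scale1r => hB.
have [W Wu W1] := hermitian_psd_unit_congr1 pA Au.
have hWB : W *m B *m W^t* \is hermsymmx.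
  apply/is_hermitianmxP; rewrite expr0 scale1r.
  by rewrite !trmx_mul !map_mxM/= !trmxCK mulmxA -hB.
have [Q QU [D QD]] := hermitian_diag hWB.
exists (Q *m W).
  rewrite trmx_mul map_mxM/= !mulmxA -(mulmxA Q) -(mulmxA Q (W *m A)) W1 mulmx1.
  exact/unitarymxP.
by exists D; rewrite -QD trmx_mul map_mxM/= !mulmxA.
Qed.

Lemma simultaneous_diag_sum (C : numClosedFieldType) (m n : nat)
    (A : 'I_n -> 'M[C]_m) (r : 'I_n -> C) :
  (forall i, hermitian_psd (A i)) -> (forall i, 0 <= r i) ->
  \det (\sum_i A i) != 0 ->
  exists b : 'I_n -> 'I_m -> C,
   [/\ forall i j, 0 <= b i j,
       forall j, \sum_i b i j = 1,
       forall i, \tr (invmx (\sum_i A i) *m A i) = \sum_j b i j &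
       \det (\sum_i r i *: A i) =
         \det (\sum_i A i) * \prod_j \sum_i r i * b i j].
Proof.
move=> pA r0 Mu.
set M := \sum_i A i; set N := \sum_i r i *: A i.
have pM : hermitian_psd M.
  have := @hermitian_psd_sum C m n A (fun=> 1) (fun=> ler01) pA.
  by under eq_bigr => ? _ do rewrite scale1r.
have Mun : M \in unitmx by rewrite unitmxE unitfE.
have [U U1 [D UD]] :=
  simultaneous_diag pM Mun (proj1 (hermitian_psd_sum r0 pA)).
(* Only the two sums become diagonal under [U], not each [A i]. The diagonal entries of the summands
   suffice: they carry the traces and, through the diagonal image of [N], its determinant. *)
exists (fun i j => (U *m A i *m U^t* ) j j).
have bsum (s : 'I_n -> C) j : \sum_i s i * (U *m A i *m U^t*) j j =
    (U *m (\sum_i s i *: A i) *m U^t*) j j.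
  rewrite mulmx_sumr mulmx_suml summxE; apply: eq_bigr => i _.
  by rewrite -scalemxAr -scalemxAl [in RHS]mxE.
split.
- by move=> i j; apply/hermitian_psd_diag_ge0/hermitian_psd_congr/pA.
- move=> j; have := bsum (fun=> 1) j.
  under eq_bigr => ? _ do rewrite mul1r.
  under [in X in _ = X -> _]eq_bigr => ? _ do rewrite scale1r.
  by move=> ->; rewrite U1 mxE eqxx.
- move=> i; rewrite -[RHS]/(\tr _) [RHS]mxtrace_mulC mulmxA.
  suff -> : invmx M = U^t* *m U by [].
  have /mulmx1C := U1; rewrite mulmxA => h.
  by rewrite -[LHS]mul1mx -h mulmxK.
- under eq_bigr => ? _ do rewrite bsum.
  have : \det (U *m N *m U^t*) = \prod_j (U *m N *m U^t*) j j.
    by rewrite UD det_diag; apply: eq_bigr => j _; rewrite mxE eqxx.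
  move=> <-; have : \det (U *m M *m U^t*) = 1 by rewrite U1 det1.
  rewrite !det_mulmx; set u := \det U; set v := \det (U^t*) => h.
  transitivity (u * \det M * v * \det N); first by rewrite h mul1r.
  by ring.
Qed.

(** * Passage between real and complex matrices *)

Lemma hermitian_psd_real_complex (R : realType) (m : nat) (A : 'M[R]_m) :
  nonneg_def A -> hermitian_psd (map_mx (real_complex R) A).
Proof.
move=> [sA pA].
have conjr (x : R) : ((real_complex R x : R[i])^*)%R = real_complex R x.
  by apply/CrealP; rewrite complex_real.
have conjM (p q : nat) (B : 'M[R]_(p, q)) :
    (map_mx (real_complex R) B)^t* = map_mx (real_complex R) B^T.
  by apply/matrixP => i j; rewrite !mxE; exact: conjr.
split.
  by apply/is_hermitianmxP; rewrite expr0 scale1r conjM sA.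
move=> x; pose toC p q := @map_mx _ _ (real_complex R) p q.
pose a := map_mx (@complex.Re R) x; pose b := map_mx (@complex.Im R) x.
have xE : x = toC _ _ a + 'i%C *: toC _ _ b.
  by apply/matrixP => i j; rewrite !mxE [LHS]complexE.
have ci : (('i%C : R[i])^*)%R = - 'i%C.
  by apply/eqP; rewrite eq_complex/= oppr0 !eqxx.
have xcE : x^t* = toC _ _ a^T - 'i%C *: toC _ _ b^T.
  rewrite xE linearD linearZ/= map_mxD map_mxZ/= !conjM -scaleNr.
  by congr (_ + _ *: _); exact: ci.
(* Symmetry of [A] cancels the mixed terms of the form at [a + i b], leaving its values at [a] and
   at [b]. *)
have cross : a *m A *m b^T = b *m A *m a^T.
  transitivity (b *m A *m a^T)^T; first by rewrite !trmx_mul trmxK sA mulmxA.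
  by apply/matrixP => i j; rewrite !ord1 mxE.
have -> : x *m toC _ _ A *m x^t* =
    toC _ _ (a *m A *m a^T) + toC _ _ (b *m A *m b^T).
  rewrite xcE {1}xE /toC !map_mxM/= mulmxBr !mulmxDl -!scalemxAl -!scalemxAr.
  rewrite scalerA -expr2 sqr_i scaleN1r opprD opprK.
  by rewrite -!map_mxM/= cross addrA addrK.
rewrite -map_mxD mxE ler0c mxE addr_ge0//.
- by have := pA a^T; rewrite trmxK.
- by have := pA b^T; rewrite trmxK.
Qed.

End hermitian.

(** The complex [b i j] are nonnegative, hence real, so every identity pulls back along the
    injection of [R] into its complex extension. *)
Lemma simultaneous_diag_sum_real (R : realType) (m n : nat)
    (A : 'I_n -> 'M[R]_m) (r : 'I_n -> R) :
  (forall i, nonneg_def (A i)) -> (forall i, 0 <= r i) ->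
  \det (\sum_i A i) != 0 ->
  exists b : 'I_n -> 'I_m -> R,
   [/\ forall i j, 0 <= b i j,
       forall j, \sum_i b i j = 1,
       forall i, \tr (invmx (\sum_i A i) *m A i) = \sum_j b i j &
       \det (\sum_i r i *: A i) =
         \det (\sum_i A i) * \prod_j \sum_i r i * b i j].
Proof.
move=> pA r0 Mu; pose toC := real_complex R.
pose AC i := map_mx toC (A i).
have pAC i : hermitian_psd (AC i) by exact: hermitian_psd_real_complex.
have rC0 i : 0 <= toC (r i) by rewrite ler0c.
have ME : \sum_i AC i = map_mx toC (\sum_i A i) by rewrite raddf_sum.
have NE : \sum_i toC (r i) *: AC i = map_mx toC (\sum_i r i *: A i).
  by rewrite raddf_sum; apply: eq_bigr => i _; exact/esym/map_mxZ.
have MuC : \det (\sum_i AC i) != 0 by rewrite ME det_map_mx fmorph_eq0.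
have [b [b0 b1 btr bdet]] := simultaneous_diag_sum pAC rC0 MuC.
pose c i j := complex.Re (b i j).
have bE i j : b i j = toC (c i j) by rewrite [RHS]RRe_real// ger0_real.
exists c; split.
- by move=> i j; rewrite -ler0c -/toC -bE.
- move=> j; apply: (@complexI R); rewrite rmorph_sum rmorph1 -(b1 j).
  by apply: eq_bigr => i _; rewrite bE.
- move=> i; apply: (@complexI R); rewrite -trace_map_mx map_mxM map_invmx -ME.
  by rewrite btr rmorph_sum; apply: eq_bigr => j _; rewrite bE.
- apply: (@complexI R); rewrite -det_map_mx -NE bdet rmorphM ME det_map_mx.
  congr (_ * _); rewrite rmorph_prod; apply: eq_bigr => j _.
  by rewrite rmorph_sum; apply: eq_bigr => i _; rewrite bE rmorphM.
Qed.

(** * Jensen's inequality for the logarithm and for log-determinants *)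

Lemma ln_prod (R : realType) (I : Type) (s : seq I) (f : I -> R) :
  (forall i, 0 < f i) -> ln (\prod_(i <- s) f i) = \sum_(i <- s) ln (f i).
Proof.
move=> f0; elim: s => [|i s IH]; first by rewrite !big_nil ln1.
by rewrite !big_cons lnM ?posrE ?prodr_gt0// IH.
Qed.

Lemma jensen_ln (R : realType) (n : nat) (b r : 'I_n -> R) :
  (forall i, 0 <= b i) -> \sum_i b i = 1 -> (forall i, 0 < r i) ->
  0 < \sum_i r i * b i /\ \sum_i b i * ln (r i) <= ln (\sum_i r i * b i).
Proof.
move=> b0 b1 r0; set s := \sum_i r i * b i.
have rb0 i : 0 <= r i * b i by rewrite mulr_ge0// ltW.
have s0 : 0 < s.
  rewrite lt_neqAle sumr_ge0// andbT eq_sym psumr_eq0//.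
  apply/negP => /allP h; have : \sum_i b i = 0.
    rewrite big1// => i _; have /implyP/(_ isT) := h i (mem_index_enum _).
    by rewrite mulf_eq0 gt_eqF//= => /eqP.
  by rewrite b1; apply/eqP; rewrite oner_eq0.
split=> //.
(* This is [ln x <= x - 1] at [x = r i / s], averaged with weights [b]; the right-hand average
   vanishes because [s] is the mean of [r]. *)
have : \sum_i b i * (ln (r i) - ln s) <= \sum_i b i * (r i / s - 1).
  apply: ler_sum => i _; rewrite ler_wpM2l// -ln_div ?posrE//.
  have := @le_ln1Dx R (r i / s - 1); rewrite subrKC; apply.
  by rewrite ltrBDr addNr divr_gt0.
have -> : \sum_i b i * (r i / s - 1) = 0.
  under eq_bigr => i _ do rewrite mulrBr mulr1 mulrA (mulrC (b i)).
  by rewrite sumrB b1 -mulr_suml mulfV ?subrr ?gt_eqF.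
under eq_bigr => i _ do rewrite mulrBr.
by rewrite sumrB -mulr_suml b1 mul1r subr_le0.
Qed.

Lemma det_reweight_jensen (R : realType) (m n : nat)
    (A : 'I_n -> 'M[R]_m) (r : 'I_n -> R) :
  (forall i, nonneg_def (A i)) -> (forall i, 0 < r i) ->
  0 < \det (\sum_i A i) ->
  0 < \det (\sum_i r i *: A i) /\
  ln (\det (\sum_i A i)) + \sum_i \tr (invmx (\sum_i A i) *m A i) * ln (r i) <=
    ln (\det (\sum_i r i *: A i)).
Proof.
move=> pA r0 M0.
have [b [b0 b1 btr ->]] :=
  simultaneous_diag_sum_real pA (fun i => ltW (r0 i)) (lt0r_neq0 M0).
have J j := jensen_ln (fun i => b0 i j) (b1 j) r0.
have s0 j := proj1 (J j).
split; first by rewrite mulr_gt0// prodr_gt0.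
rewrite lnM ?posrE ?prodr_gt0// lerD2l ln_prod//.
(* Each trace is the sum over [j] of [b i j], so exchanging the sums leaves one Jensen inequality
   per diagonal position [j]. *)
under eq_bigr => i _ do rewrite btr mulr_suml.
by rewrite exchange_big/=; apply: ler_sum => j _; case: (J j).
Qed.

Lemma trace_invmx_ge0 (R : realType) (m n : nat) (A : 'I_n -> 'M[R]_m) i :
  (forall i, nonneg_def (A i)) -> 0 < \det (\sum_i A i) ->
  0 <= \tr (invmx (\sum_i A i) *m A i).
Proof.
move=> pA M0.
have [b [b0 _ -> _]] :=
  simultaneous_diag_sum_real pA (fun=> ler01) (lt0r_neq0 M0).
exact: sumr_ge0.
Qed.

Lemma trace_invmx_sum (R : realType) (m n : nat) (A : 'I_n -> 'M[R]_m) :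
  0 < \det (\sum_i A i) -> \sum_i \tr (invmx (\sum_i A i) *m A i) = m%:R.
Proof.
move=> M0; rewrite -raddf_sum -mulmx_sumr mulVmx/= ?mxtrace1//.
by rewrite unitmxE unitfE lt0r_neq0.
Qed.

(** * One-variable inequalities for the logarithm *)

Lemma gtr0_derive_gt0 (R : realType) (f df : R -> R) (s : R) :
  1 < s -> (forall x : R, 1 <= x -> is_derive x 1 f (df x)) ->
  (forall x, 1 < x -> 0 < df x) -> f 1 = 0 -> 0 < f s.
Proof.
move=> s1 hd hp f1.
have [||c] := @MVT R f df 1 s s1.
- by move=> x; rewrite in_itv/= => /andP[/ltW ? _]; exact: hd.
- apply: derivable_within_continuous => x; rewrite in_itv/= => /andP[? _].
  by apply: ex_derive; exact: hd.
rewrite in_itv/= f1 subr0 => /andP[c1 _] ->.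
by rewrite mulr_gt0 ?subr_gt0//; exact: hp.
Qed.

(** The Padé approximant [2 * (s - 1) / (s + 1)] equals [2 - 4 / (s + 1)]; its gap to [ln] vanishes
    at 1 and has a derivative with numerator [(x - 1)^2]. *)
Lemma ln_gt_pade (R : realType) (s : R) : 1 < s -> 2 * (s - 1) < (s + 1) * ln s.
Proof.
move=> s1.
have : 0 < ln s - (2 - 4 * (s + 1)^-1).
  apply: (@gtr0_derive_gt0 R (fun s => ln s - (2 - 4 * (s + 1)^-1))
    (fun x => x^-1 - 4 * ((x + 1) ^- 2)) s s1).
  - move=> x x1.
    have x0 : 0 < x by lra.
    have x10 : x + 1 != 0 by lra.
    have dx1 := is_deriveD (is_derive_id x 1) (is_derive_cst (1 : R) x (1 : R)).
    have dV := is_deriveZ 4 (@is_deriveV R (id + cst 1) x _ 1 x10 dx1).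
    have dB := is_deriveB (is_derive_cst (2 : R) x (1 : R)) dV.
    apply: (is_derive_eq (is_deriveB (is_derive1_ln x0) dB)).
    by rewrite fctE /GRing.scale/=; field; lra.
  - move=> x x1.
    have -> : x^-1 - 4 * ((x + 1) ^- 2) = (x - 1)^+2 / (x * (x + 1)^+2).
      by field; lra.
    by rewrite divr_gt0 ?mulr_gt0 ?exprn_gt0; lra.
  - by rewrite ln1; field; lra.
rewrite /= subr_gt0 => h.
have -> : 2 * (s - 1) = (s + 1) * (2 - 4 * (s + 1)^-1) by field; lra.
by rewrite ltr_pM2l//; lra.
Qed.

Lemma ln_lt_half (R : realType) (s : R) : 1 < s -> ln s < 2^-1 * (s - s^-1).
Proof.
move=> s1.
have : 0 < 2^-1 * (s - s^-1) - ln s.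
  apply: (@gtr0_derive_gt0 R (fun s => 2^-1 * (s - s^-1) - ln s)
    (fun x => (1 + x ^- 2) / 2 - x^-1) s s1).
  - move=> x x1.
    have x0 : 0 < x by lra.
    have x10 : x != 0 by lra.
    have dV := @is_deriveV R id x _ 1 x10 (is_derive_id x (1 : R)).
    have dB := is_deriveB (is_derive_id x (1 : R)) dV.
    apply: (is_derive_eq (is_deriveB (is_deriveZ 2^-1 dB) (is_derive1_ln x0))).
    by rewrite /GRing.scale/=; field; lra.
  - move=> x x1.
    have -> : (1 + x ^- 2) / 2 - x^-1 = (x - 1)^+2 / (2 * x^+2).
      by field; lra.
    by rewrite divr_gt0 ?mulr_gt0 ?exprn_gt0; lra.
  - by rewrite ln1; field; lra.
by rewrite /= subr_gt0.
Qed.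

(** Right side subtracted from left is affine in [rho] with slope [ln r - (r - 1) <= 0], so the
    worst case is the largest admissible [rho]: [rho = r] when [r < 1], which is [ln_lt_half] at
    [r^-1], and [rho = 1] when [r > 1], which is [ln_gt_pade]. *)
Lemma shifted_entropy_gt (R : realType) (r rho : R) : 0 < r -> r != 1 ->
  rho <= 1 -> rho <= r -> (1 + rho) * (r - 1) < (r + rho) * ln r.
Proof.
move=> r0 rn1 rho1 rhor.
have le1 : ln r <= r - 1.
  by have := @le_ln1Dx R (r - 1); rewrite subrKC; apply; lra.
have [r1|r1|re] := ltgtP r 1; last by rewrite re eqxx in rn1.
- have s1 : 1 < r^-1 by rewrite invf_gt1.
  have := ln_lt_half s1; rewrite lnV ?posrE// invrK => h.
  have : r * (- ln r) < r * (2^-1 * (r^-1 - r)) by rewrite ltr_pM2l.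
  have -> : r * (2^-1 * (r^-1 - r)) = (1 - r^+2) / 2 by field; lra.
  have : 0 <= (r - rho) * ((r - 1) - ln r) by rewrite mulr_ge0; lra.
  by nra.
- have := ln_gt_pade r1.
  have : 0 <= (1 - rho) * ((r - 1) - ln r) by rewrite mulr_ge0; lra.
  by nra.
Qed.

(** * Measurability of determinants, inverses and traces; linearity of the integral *)

Lemma measurable_det d (T : measurableType d) (R : realType) (m : nat)
    (M : T -> 'M[R]_m) :
  (forall j k, measurable_fun setT (fun t => M t j k)) ->
  measurable_fun setT (fun t => \det (M t)).
Proof.
move=> hM; apply: measurable_sum => s; apply: measurable_funM => //.
by apply: measurable_prod => i _; exact: hM.
Qed.

Lemma measurable_adjugate d (T : measurableType d) (R : realType) (m : nat)
    (M : T -> 'M[R]_m) j k :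
  (forall j k, measurable_fun setT (fun t => M t j k)) ->
  measurable_fun setT (fun t => (\adj (M t)) j k).
Proof.
move=> hM; under eq_fun do rewrite mxE.
apply: measurable_funM => //; apply: measurable_det => p q.
by under eq_fun do rewrite !mxE; exact: hM.
Qed.

Lemma measurable_inv (R : realType) : measurable_fun setT (@GRing.inv R).
Proof.
(* Away from 0 the inverse is [x / x^2]; writing [1 / x^2] as an exponential covers both signs of
   [x] by measurable functions. *)
have -> : (@GRing.inv R) =
    fun x => if x == 0 then 0 else x * expR (- ln (x ^+ 2)).
  apply/funext => x; case: eqVneq => [->|x0]; first by rewrite invr0.
  have x2 : 0 < x ^+ 2 by rewrite exprn_even_gt0.
  by rewrite expRN lnK ?posrE//; field.
apply: measurable_fun_ifT => //; first exact: measurable_fun_eqr.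
apply: measurable_funM => //; apply: measurableT_comp => //.
by apply: measurableT_comp => //; apply: measurableT_comp => //.
Qed.

Lemma measurable_trace_invmx d (T : measurableType d) (R : realType) (m : nat)
    (M A : T -> 'M[R]_m) :
  (forall j k, measurable_fun setT (fun t => M t j k)) ->
  (forall j k, measurable_fun setT (fun t => A t j k)) ->
  measurable_fun setT (fun t => \tr (invmx (M t) *m A t)).
Proof.
move=> hM hA; apply: measurable_sum => i; under eq_fun do rewrite mxE.
apply: measurable_sum => j; apply: measurable_funM => //.
(* [invmx] is the adjugate over the determinant on units and the matrix itself elsewhere; the two
   branches are treated separately. *)
rewrite /invmx; under eq_fun do rewrite unitmxE unitfE.
under eq_fun do rewrite (fun_if (fun B : 'M[R]_m => B i j)).
apply: measurable_fun_ifT => //.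
- apply: measurable_neg; apply: measurable_fun_eqr => //.
  exact: measurable_det.
- under eq_fun do rewrite mxE; apply: measurable_funM.
    by apply: measurableT_comp; [exact: measurable_inv|exact: measurable_det].
  exact: measurable_adjugate.
Qed.

Lemma Rintegral_lincomb d (T : measurableType d) (R : realType)
    (P : {measure set T -> \bar R}) (I : Type) (s : seq I) (c : I -> R)
    (f : I -> T -> R) :
  (forall i, P.-integrable setT (EFin \o f i)) ->
  P.-integrable setT (EFin \o (fun t => \sum_(i <- s) c i * f i t)) /\
  Rintegral P setT (fun t => \sum_(i <- s) c i * f i t) =
    \sum_(i <- s) c i * Rintegral P setT (f i).
Proof.
move=> hf; elim: s => [|i s [IH1 IH2]].
  rewrite big_nil; under eq_fun do rewrite big_nil.
  split; last by rewrite /Rintegral integral0_eq.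
  exact: integrable0.
have hi : P.-integrable setT (EFin \o (fun t => c i * f i t)).
  by apply: eq_integrable (integrableZl measurableT (c i) (hf i)) => //.
rewrite big_cons -IH2 -RintegralZl// -RintegralD//.
under [in X in X /\ _]eq_fun do rewrite big_cons.
split; last by apply: eq_Rintegral => t _; rewrite big_cons.
by apply: eq_integrable (integrableD measurableT hi IH1) => //.
Qed.

Lemma nonneg_defZ (R : realType) (m : nat) (A : 'M[R]_m) (a : R) :
  0 <= a -> nonneg_def A -> nonneg_def (a *: A).
Proof.
move=> a0 [sA pA]; split; first by rewrite linearZ/= sA.
by move=> x; rewrite -scalemxAr -scalemxAl mxE mulr_ge0.
Qed.

(** * The information matrix at a fixed parameter *)

Section infoM_pointwise.
Variables (R : realType) (T : Type) (n m : nat) (A : 'I_n -> T -> 'M[R]_m).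
Hypothesis hAnnd : forall i t, nonneg_def (A i t).

Lemma infoM_jensen (w w' : 'I_n -> R) t :
  (forall i, 0 < w i) -> (forall i, 0 < w' i) -> 0 < \det (infoM A w t) ->
  0 < \det (infoM A w' t) /\
  ln (\det (infoM A w t)) +
    \sum_i (w i * ln (w' i / w i)) * \tr (invmx (infoM A w t) *m A i t) <=
    ln (\det (infoM A w' t)).
Proof.
move=> w0 w0' M0.
have pA i : nonneg_def (w i *: A i t) by apply: nonneg_defZ => //; exact: ltW.
have [|] := @det_reweight_jensen R m n (fun i => w i *: A i t)
  (fun i => w' i / w i) pA _ M0; first by move=> i; rewrite divr_gt0.
have -> : \sum_i (w' i / w i) *: (w i *: A i t) = infoM A w' t.
  by apply: eq_bigr => i _; rewrite scalerA mulfVK// gt_eqF.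
move=> M0' J; split=> //; apply: le_trans J; rewrite lerD2l ler_sum// => i _.
by rewrite -scalemxAr mxtraceZ mulrAC.
Qed.

(** Jensen in both directions: singularity at [t] does not depend on the choice of positive
    weights. *)
Lemma infoM_det_gt0 (w w' : 'I_n -> R) t :
  (forall i, 0 < w i) -> (forall i, 0 < w' i) ->
  (0 < \det (infoM A w t)) = (0 < \det (infoM A w' t)).
Proof.
by move=> w0 w0'; apply/idP/idP => M0; [have [] := infoM_jensen w0 w0' M0|
  have [] := infoM_jensen w0' w0 M0].
Qed.

Lemma infoM_trace_sum (w : 'I_n -> R) t : 0 < \det (infoM A w t) ->
  \sum_i w i * \tr (invmx (infoM A w t) *m A i t) = m%:R.
Proof.
move=> M0; rewrite -(trace_invmx_sum M0); apply: eq_bigr => i _.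
by rewrite -scalemxAr mxtraceZ.
Qed.

(** The weighted traces are nonnegative and sum to [m], so none exceeds [m]. This bound makes the
    integrands of [dfun] integrable. *)
Lemma infoM_trace_bound (w : 'I_n -> R) t i : (forall i, 0 < w i) ->
  0 < \det (infoM A w t) ->
  0 <= \tr (invmx (infoM A w t) *m A i t) <= m%:R / w i.
Proof.
move=> w0 M0.
have tr0 j : 0 <= \tr (invmx (infoM A w t) *m A j t).
  have pA k : nonneg_def (w k *: A k t) by apply: nonneg_defZ => //; exact: ltW.
  have := trace_invmx_ge0 j pA M0.
  by rewrite -scalemxAr mxtraceZ pmulr_rge0.
rewrite tr0 ler_pdivlMr// mulrC -(infoM_trace_sum M0) (bigD1 i)//= lerDl.
by rewrite sumr_ge0// => j _; rewrite mulr_ge0// ltW.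
Qed.

(** Changing the weights moves the log-determinant by at most a constant free of [t], so
    integrability passes from one positive design to all. In the singular case both logarithms are 0
    by the convention for [ln]. *)
Lemma infoM_ln_det_lb (w w' : 'I_n -> R) t :
  (forall i, 0 < w i) -> (forall i, 0 < w' i) ->
  ln (\det (infoM A w t)) - m%:R * \sum_i `|ln (w' i / w i)| <=
    ln (\det (infoM A w' t)).
Proof.
move=> w0 w0'; case: (ltP 0 (\det (infoM A w t))) => [M0|M0]; last first.
  rewrite ln0// sub0r ln0; last first.
    by rewrite leNgt -(infoM_det_gt0 _ w0 w0') -leNgt.
  by rewrite oppr_le0 mulr_ge0// sumr_ge0.
have [_] := infoM_jensen w0 w0' M0; apply: le_trans; rewrite lerD2l lerNl.
rewrite mulr_sumr -sumrN ler_sum// => i _.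
have /andP[tr0] := infoM_trace_bound i w0 M0; rewrite ler_pdivlMr// => trm.
rewrite mulrAC -mulrN.
apply: (@le_trans _ _
  (w i * \tr (invmx (infoM A w t) *m A i t) * `|ln (w' i / w i)|)).
  by rewrite ler_wpM2l ?mulr_ge0 ?(ltW (w0 i))// -normrN ler_norm.
by rewrite ler_wpM2r// mulrC.
Qed.

End infoM_pointwise.

(** * Integration over the prior *)

Section infoM_integral.
Variables (R : realType) (d : measure_display) (T : measurableType d).
Variables (P : probability T R) (n m : nat) (A : 'I_n -> T -> 'M[R]_m).
Hypothesis hAmeas :
  forall i (j k : 'I_m), measurable_fun setT (fun t => A i t j k).
Hypothesis hAnnd : forall i t, nonneg_def (A i t).

Lemma measurable_infoM (w : 'I_n -> R) j k :
  measurable_fun setT (fun t => infoM A w t j k).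
Proof.
under eq_fun do rewrite summxE; apply: measurable_sum => i.
by under eq_fun do rewrite mxE; apply: measurable_funM.
Qed.

Lemma measurable_ln_det_infoM (w : 'I_n -> R) :
  measurable_fun setT (fun t => ln (\det (infoM A w t))).
Proof.
apply: measurableT_comp => //; apply: measurable_det => j k.
exact: measurable_infoM.
Qed.

Lemma measurable_infoM_det_gt0 (w : 'I_n -> R) :
  measurable_fun setT (fun t => 0 < \det (infoM A w t)).
Proof.
apply: measurable_fun_ltr => //; apply: measurable_det => j k.
exact: measurable_infoM.
Qed.

Lemma measurable_logdet_infoM (w : 'I_n -> R) :
  measurable_fun setT (fun t => logdet (infoM A w t)).
Proof.
apply: measurable_fun_ifT => //; first exact: measurable_infoM_det_gt0.
by apply/measurable_EFinP; exact: measurable_ln_det_infoM.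
Qed.

Variable w : 'I_n -> R.
Hypothesis w_gt0 : forall i, 0 < w i.
Hypothesis phi_fin : phiD P A w \is a fin_num.

Lemma integrable_logdet_infoM :
  P.-integrable setT (fun t => logdet (infoM A w t)).
Proof.
apply/integrableP; split; first exact: measurable_logdet_infoM.
apply/abse_integralP => //; first exact: measurable_logdet_infoM.
by move: phi_fin; rewrite fin_num_abs.
Qed.

(** An integrable function is finite almost everywhere, so [logdet] at [w] is rarely [-oo];
    nonsingularity then transfers to [w']. *)
Lemma ae_infoM_det_gt0 (w' : 'I_n -> R) : (forall i, 0 < w' i) ->
  {ae P, forall t, 0 < \det (infoM A w' t)}.
Proof.
move=> w'0; have := integrable_ae measurableT integrable_logdet_infoM.
apply: filterS => t /(_ I); rewrite /logdet (infoM_det_gt0 hAnnd t w_gt0 w'0).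
by case: ifP.
Qed.

Lemma integrable_ln_det_infoM (w' : 'I_n -> R) : (forall i, 0 < w' i) ->
  P.-integrable setT (EFin \o (fun t => ln (\det (infoM A w' t)))).
Proof.
move=> w'0.
have iw : P.-integrable setT (EFin \o (fun t => ln (\det (infoM A w t)))).
  apply: (le_integrable measurableT _ _ integrable_logdet_infoM).
    by apply/measurable_EFinP; exact: measurable_ln_det_infoM.
  move=> t _; rewrite /logdet /=; case: ifPn => //; rewrite -leNgt => M0.
  by rewrite ln0// normr0 leey.
(* The two terms are the constants of [infoM_ln_det_lb] for the two orders of the weights, so [K]
   dominates both. *)
pose K := m%:R * \sum_i `|ln (w' i / w i)| + m%:R * \sum_i `|ln (w i / w' i)|.
have K1 : 0 <= m%:R * \sum_i `|ln (w' i / w i)| by rewrite mulr_ge0// sumr_ge0.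
have K2 : 0 <= m%:R * \sum_i `|ln (w i / w' i)| by rewrite mulr_ge0// sumr_ge0.
have iK := finite_measure_integrable_cst P K (@measurableT _ T).
apply: (le_integrable measurableT _ _
  (integrableD measurableT (integrable_abse iw) iK)).
  by apply/measurable_EFinP; exact: measurable_ln_det_infoM.
move=> t _ /=; rewrite lee_fin.
rewrite [leRHS]ger0_norm ?addr_ge0 ?/K ?addr_ge0//.
have := infoM_ln_det_lb hAnnd t w_gt0 w'0.
have := infoM_ln_det_lb hAnnd t w'0 w_gt0.
have := ler_norm (ln (\det (infoM A w t))).
have := ler_norm (- ln (\det (infoM A w t))).
rewrite normrN ler_norml; lra.
Qed.

Lemma phiD_EFin (w' : 'I_n -> R) : (forall i, 0 < w' i) ->
  phiD P A w' = (Rintegral P setT (fun t => ln (\det (infoM A w' t))))%:E.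
Proof.
move=> w'0; rewrite /Rintegral fineK; last first.
  exact/integrable_fin_num/integrable_ln_det_infoM.
apply: ae_eq_integral => //; first exact: measurable_logdet_infoM.
  by apply/measurable_EFinP; exact: measurable_ln_det_infoM.
by apply: filterS (ae_infoM_det_gt0 w'0) => t M0 _; rewrite /logdet M0.
Qed.

(* Zero where [M] is singular, since [invmx M] is then the junk value [M]. *)
Definition trace_at (w' : 'I_n -> R) i t : R :=
  if 0 < \det (infoM A w' t) then \tr (invmx (infoM A w' t) *m A i t) else 0.

Lemma measurable_trace_at w' i : measurable_fun setT (trace_at w' i).
Proof.
apply: measurable_fun_ifT => //; first exact: measurable_infoM_det_gt0.
by apply: measurable_trace_invmx => // j k; exact: measurable_infoM.
Qed.

Lemma integrable_trace_at w' i : (forall i, 0 < w' i) ->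
  P.-integrable setT (EFin \o trace_at w' i).
Proof.
move=> w'0.
have iK := finite_measure_integrable_cst P (m%:R / w' i) (@measurableT _ T).
apply: (le_integrable measurableT _ _ iK).
  by apply/measurable_EFinP; exact: measurable_trace_at.
have K0 : 0 <= m%:R / w' i by rewrite divr_ge0// ltW.
move=> t _ /=; rewrite lee_fin [leRHS]ger0_norm// /trace_at.
case: ifPn => [M0|_]; last by rewrite normr0.
by have /andP[? ?] := infoM_trace_bound hAnnd i w'0 M0; rewrite ger0_norm.
Qed.

Lemma dfunE w' i : (forall i, 0 < w' i) ->
  dfun P A i w' = Rintegral P setT (trace_at w' i).
Proof.
move=> w'0; congr fine; apply: ae_eq_integral => //.
- apply/measurable_EFinP; apply: measurable_trace_invmx => // j k.
  exact: measurable_infoM.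
- by apply/measurable_EFinP; exact: measurable_trace_at.
- by apply: filterS (ae_infoM_det_gt0 w'0) => t M0 _; rewrite /trace_at M0.
Qed.

Lemma dfun_sum w' : (forall i, 0 < w' i) ->
  \sum_i w' i * dfun P A i w' = m%:R.
Proof.
move=> w'0; under eq_bigr => i _ do rewrite dfunE//.
have [iS <-] := Rintegral_lincomb (index_enum 'I_n) w'
  (fun i => integrable_trace_at i w'0).
have -> : (m%:R : R) = Rintegral P setT (cst m%:R).
  have -> := Rintegral_cst P (@measurableT _ T) (m%:R : R).
  by rewrite [X in _ * X](congr1 fine (probability_setT P)) mulr1.
congr fine; apply: ae_eq_integral => //.
  by apply/measurable_EFinP; apply: measurable_sum => i;
    apply: measurable_funM => //; exact: measurable_trace_at.
  exact/measurable_EFinP.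
apply: filterS (ae_infoM_det_gt0 w'0) => t M0 _ /=.
rewrite -(infoM_trace_sum M0); congr EFin; apply: eq_bigr => i _.
by rewrite /trace_at M0.
Qed.

Lemma phiD_jensen (u v : 'I_n -> R) :
  (forall i, 0 < u i) -> (forall i, 0 < v i) ->
  (phiD P A u + (\sum_i u i * ln (v i / u i) * dfun P A i u)%:E <=
   phiD P A v)%E.
Proof.
move=> u0 v0; rewrite !phiD_EFin// -EFinD lee_fin.
under eq_bigr => i _ do rewrite dfunE//.
have [iS <-] := Rintegral_lincomb (index_enum 'I_n)
  (fun i => u i * ln (v i / u i)) (fun i => integrable_trace_at i u0).
rewrite -RintegralD//; last exact: integrable_ln_det_infoM.
apply: le_Rintegral => //; last 1 first.
- move=> t _; case: (ltP 0 (\det (infoM A u t))) => M0.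
    have [_] := infoM_jensen hAnnd u0 v0 M0; apply: le_trans.
    by rewrite lerD2l ler_sum// => i _; rewrite /trace_at M0.
  (* At a singular [t] the traces and both logarithms are 0, so the comparison of integrands holds
     everywhere. *)
  rewrite big1 => [|i _]; last by rewrite /trace_at ltNge M0 mulr0.
  by rewrite addr0 !ln0// leNgt -(infoM_det_gt0 hAnnd t u0 v0) -leNgt.
- apply: eq_integrable
    (integrableD measurableT (integrable_ln_det_infoM u0) iS) => //.
- exact: integrable_ln_det_infoM.
Qed.

End infoM_integral.

Theorem theorem1 (R : realType) (d : measure_display) (T : measurableType d)
  (P : probability T R) (n m : nat) (hn : (0 < n)%N) (hm : (0 < m)%N)
  (A : 'I_n -> T -> 'M[R]_m)
  (hAmeas : forall i (j k : 'I_m), measurable_fun setT (fun t => A i t j k))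
  (hAnnd : forall i t, nonneg_def (A i t))
  (hfin : exists w, Omega w /\ phiD P A w \is a fin_num)
  (w0 w1 : 'I_n -> R) (alpha : R)
  (hw0 : Omega w0) (hw1 : Omega w1)
  (hupd : forall i, w1 i = w0 i * ((dfun P A i w0 - alpha) / (m%:R - alpha)))
  (halpha : forall i, alpha <= dfun P A i w0 / 2) :
  (phiD P A w0 <= phiD P A w1)%E /\ (phiD P A w1 = phiD P A w0 -> w1 = w0).
Proof.
have [wf [[_ wf0] phi_fin]] := hfin.
have [w0_sum w0_gt0] := hw0; have [w1_sum w1_gt0] := hw1.
pose D i := dfun P A i w0; pose r i := w1 i / w0 i.
have D_sum : \sum_i w0 i * D i = m%:R.
  exact: (dfun_sum hAmeas hAnnd wf0 phi_fin w0_gt0).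
have m1 : 1 <= m%:R :> R by rewrite ler1n.
(* Averaging the bound on [alpha] under [w0], where [D] has mean [m]; this gives [m - alpha > 0] and
   [rho <= 1]. *)
have alpha_le : alpha <= m%:R / 2.
  have : \sum_i w0 i * alpha <= \sum_i w0 i * (D i / 2).
    by apply: ler_sum => i _; rewrite ler_wpM2l ?halpha// ltW.
  rewrite -mulr_suml w0_sum mul1r.
  by under eq_bigr => i _ do rewrite mulrA; rewrite -mulr_suml D_sum.
pose rho := alpha / (m%:R - alpha).
have ma0 : 0 < m%:R - alpha by lra.
have rE i : r i = (D i - alpha) / (m%:R - alpha).
  by rewrite /r hupd mulrC mulKf ?gt_eqF.
have r_gt0 i : 0 < r i by rewrite divr_gt0.
have rho1 : rho <= 1 by rewrite ler_pdivrMr//; lra.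
have rho_r i : rho <= r i.
  by rewrite rE ler_pM2r ?invr_gt0//; have := halpha i; rewrite -/(D i); lra.
have DE i : D i = (m%:R - alpha) * (r i + rho) by rewrite rE /rho; field; lra.
(* The weighted gap between [(x + rho) * ln x] and its tangent at 1, taken at [x = r i]. *)
pose gain i := w0 i * (m%:R - alpha) *
  ((r i + rho) * ln (r i) - (1 + rho) * (r i - 1)).
have wma0 i : 0 < w0 i * (m%:R - alpha) by rewrite mulr_gt0.
have gain_gt0 i : r i != 1 -> 0 < gain i.
  move=> r1; rewrite mulr_gt0// subr_gt0; exact: shifted_entropy_gt.
have gain_ge0 i : 0 <= gain i.
  case: (eqVneq (r i) 1) => [r1|/gain_gt0/ltW//].
  by rewrite /gain r1 ln1 subrr !mulr0 subrr mulr0.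
(* The tangent terms add up to a multiple of the sum of [w1 i - w0 i], which is 0. *)
have gain_sum : \sum_i w0 i * ln (r i) * D i = \sum_i gain i.
  have r1_sum : \sum_i (w1 i - w0 i) = 0 by rewrite sumrB w0_sum w1_sum subrr.
  apply/eqP; rewrite -subr_eq0 -sumrB; apply/eqP.
  transitivity ((m%:R - alpha) * (1 + rho) * \sum_i (w1 i - w0 i)).
    rewrite mulr_sumr; apply: eq_bigr => i _.
    have -> : w1 i = w0 i * r i by rewrite /r mulrC divfK// gt_eqF.
    by rewrite DE /gain; ring.
  by rewrite r1_sum mulr0.
have := phiD_jensen hAmeas hAnnd wf0 phi_fin w0_gt0 w1_gt0.
rewrite -/(D _) gain_sum => J.
split.
  by apply: le_trans J; rewrite leeDl// lee_fin sumr_ge0.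
move=> phiE; move: J.
(* Finiteness of [phiD] at [w0] allows cancellation, so equality forces the total gain to be at most
   0, while any [r i != 1] would make it positive. *)
rewrite phiE (phiD_EFin hAmeas hAnnd wf0 phi_fin w0_gt0) -EFinD lee_fin gerDl.
move=> gain_le0; apply/funext => i; apply/eqP; apply: contraTT gain_le0 => w10.
rewrite -ltNge (bigD1 i)//= ltr_pwDl ?sumr_ge0// gain_gt0//.
by apply: contraNneq w10 => /divr1_eq ->.
Qed.
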